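(* Let $N$ be a semi-invariant submanifold of a nondegenerate $(g,F,\mu)$-manifold $M$, with $F$-invariant distribution $D$, anti-invariant distribution $D^{\perp}$, and $\varphi=F\circ P$ where $P:TN\to D$ is the orthogonal projection. Then $D^{\perp}$ is integrable if and only if the Nijenhuis tensor field of $\varphi$ vanishes identically on $D^{\perp}$, i.e. $N_\varphi(X,Y)=0$ for all $X,Y\in\Gamma(D^{\perp})$.
   Context: All objects are smooth; $\Gamma(V)$ denotes the smooth sections of a vector bundle $V$. Fix $\mu\in\{-1,+1\}$. A $(g,F,\mu)$-manifold is a manifold $M$ with a Riemannian metric $g$ and a $(1,1)$-tensor field $F$ such that $g(FX,Y)+\mu g(X,FY)=0$ for all vector fields $X,Y$ on $M$. It is nondegenerate if $F_x:T_xM\to T_xM$ is nondegenerate (invertible) at every $x\in M$. A submanifold $N$ of $M$ (with induced metric, also denoted $g$, and normal bundle $T^{\perp}N$) is semi-invariant if there is a distribution $D$ on $N$ such that: (i) $F(D_x)\subset D_x$ for all $x\in N$; (ii) the orthogonal complement $D^{\perp}$ of $D$ in $TN$ satisfies $F(D^{\perp}_x)\subset T^{\perp}_xN$ for all $x\in N$; (iii) $F^2(D^{\perp})$ is a distribution on $N$ (a subbundle of $TN$). $P$ is the projection of $TN=D\oplus D^{\perp}$ onto $D$, and $\varphi=F\circ P$ is a $(1,1)$-tensor field on $N$. Its Nijenhuis tensor field is $N_\varphi(X,Y)=[\varphi X,\varphi Y]+\varphi^2[X,Y]-\varphi[\varphi X,Y]-\varphi[X,\varphi Y]$ for $X,Y\in\Gamma(TN)$.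 *)

(* Defs.v *)
From HB Require Import structures.
From mathcomp Require Import all_boot all_order all_algebra.
From mathcomp Require Import mathcomp_extra boolp classical_sets functions.
From mathcomp Require Import ring.
From mathcomp Require Import reals interval_inference topology normedtype landau derive.

Set Implicit Arguments.
Unset Strict Implicit.
Unset Printing Implicit Defensive.

Import Order.TTheory GRing.Theory Num.Theory.
Import numFieldNormedType.Exports.

Local Open Scope classical_set_scope.
Local Open Scope ring_scope.

Section EuclideanSmoothness.
Context {R : realType}.

Section SmoothOn.
Variables V W : normedModType R.

(* On an open set U, f is C^oo iff all its iterated directional derivatives are
   Frechet differentiable at every point of U. *)
Fixpoint diff_on (k : nat) (U : set V) (f : V -> W) : Prop :=
  (forall x, U x -> differentiable f x) /\
  (if k is k'.+1 then forall v, diff_on k' U ('D_v f) else True).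

Definition smooth_on (U : set V) (f : V -> W) : Prop :=
  forall k, diff_on k U f.

End SmoothOn.

Section Closure.
Variables (V : normedModType R).
Implicit Types (W : normedModType R) (U : set V).

Lemma diff_on_diff W k U (f : V -> W) x :
  diff_on k U f -> U x -> differentiable f x.
Proof. by case: k => [|k] [+ _]; apply. Qed.

Lemma diff_onS W k U (f : V -> W) : diff_on k.+1 U f -> diff_on k U f.
Proof.
elim: k f => [|k IH] f [df Df]; first by split.
by split=> // v; apply/IH/Df.
Qed.

Lemma near_eq_differentiable W (f g : V -> W) x :
  (\near x, f x = g x) -> differentiable f x -> differentiable g x.
Proof.
move=> fg df; have fgx : f x = g x := nbhs_singleton fg.
suff h0 : differentiable (g - f) x.
  rewrite (_ : g = f + (g - f)); first exact: differentiableD.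
  by apply/funext => y; rewrite !fctE addrC subrK.
have cz : continuous (\0 : {linear V -> W}) by exact: cst_continuous.
have hz : (g - f) \o shift x =
    cst ((g - f) x) + (\0 : {linear V -> W}) +o_ 0 id.
  apply/eqaddoP => _/posnumP[e].
  have : \forall y \near 0, f (y + x) = g (y + x).
    by move: fg; rewrite (near_shift 0) /= subr0.
  apply: filterS => y fgy.
  by rewrite !fctE /= fgy fgx !subrr addr0 subrr normr0 mulr_ge0.
by apply/diff_locallyP; rewrite (diff_unique cz hz).
Qed.

Let locdiff W k U (f : V -> W) :
  (forall x, U x -> exists A (g : V -> W),
     [/\ open A, A x, diff_on k A g & forall y, A y -> f y = g y]) ->
  forall x, U x -> differentiable f x.
Proof.
move=> H x Ux; have [A [g [oA Ax dg fg]]] := H _ Ux.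
apply: near_eq_differentiable (diff_on_diff dg Ax).
by apply: filterS (open_nbhs_nbhs (conj oA Ax)) => y /fg.
Qed.

Lemma diff_on_local W k U (f : V -> W) :
  (forall x, U x -> exists A (g : V -> W),
     [/\ open A, A x, diff_on k A g & forall y, A y -> f y = g y]) ->
  diff_on k U f.
Proof.
elim: k f => [|k IH] f H; split=> //.
- exact: locdiff H.
- exact: locdiff H.
move=> v; apply: IH => x Ux; have [A [g [oA Ax [_ Dg] fg]]] := H _ Ux.
exists A, ('D_v g); split=> // [|y Ay]; first exact: Dg.
apply: near_eq_derive.
by apply: filterS (open_nbhs_nbhs (conj oA Ay)) => z /fg.
Qed.

Lemma diff_on_eq W k U (f g : V -> W) :
  open U -> (forall x, U x -> f x = g x) -> diff_on k U g -> diff_on k U f.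
Proof. by move=> oU fg dg; apply: diff_on_local => x Ux; exists U, g. Qed.

Lemma diff_onW W k U U' (f : V -> W) :
  U' `<=` U -> diff_on k U f -> diff_on k U' f.
Proof.
move=> sU; elim: k f => [|k IH] f [df Df]; split=> //.
- by move=> x /sU; apply: df.
- by move=> x /sU; apply: df.
- by move=> v; apply/IH/Df.
Qed.

Lemma diff_on_cst W k U (a : W) : diff_on k U (cst a : V -> W).
Proof.
elim: k a => [|k IH] a; split=> //.
by move=> v; rewrite (_ : 'D_v _ = cst 0) //; apply/funext => x; exact: derive_cst.
Qed.

Lemma diff_onD W k U (f g : V -> W) :
  open U -> diff_on k U f -> diff_on k U g -> diff_on k U (f + g).
Proof.
move=> oU; elim: k f g => [|k IH] f g [df Df] [dg Dg]; split=> //.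
- by move=> x Ux; apply: differentiableD; [apply: df|apply: dg].
- by move=> x Ux; apply: differentiableD; [apply: df|apply: dg].
move=> v; apply: (@diff_on_eq _ _ _ _ ('D_v f + 'D_v g)) => //.
  by move=> x Ux; rewrite deriveD //; apply: diff_derivable; [apply: df|apply: dg].
by apply: IH; [apply: Df|apply: Dg].
Qed.

Lemma diff_on_lin (W W' : normedModType R) k U (L : {linear W -> W'})
    (f : V -> W) :
  continuous L -> open U -> diff_on k U f -> diff_on k U (L \o f).
Proof.
move=> cL oU; elim: k f => [|k IH] f [df Df]; split=> //.
- by move=> x Ux; apply: differentiable_comp (df _ Ux) _; exact: linear_differentiable.
- by move=> x Ux; apply: differentiable_comp (df _ Ux) _; exact: linear_differentiable.
move=> v; apply: (@diff_on_eq _ _ _ _ (L \o 'D_v f)); [by []| |exact/IH/Df].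
move=> x Ux; have dfx := df _ Ux; have dL y : differentiable L y by exact: linear_differentiable.
have dLf : differentiable (L \o f) x by exact: differentiable_comp.
by rewrite (deriveE v dLf) diff_comp // diff_lin //= (deriveE v dfx).
Qed.

Lemma diff_onM k U (f g : V -> R) :
  open U -> diff_on k U f -> diff_on k U g -> diff_on k U (f * g).
Proof.
have dM j (f' g' : V -> R) : diff_on j U f' -> diff_on j U g' ->
    forall x, U x -> differentiable (f' * g') x.
  move=> Hf Hg x Ux.
  by apply: differentiableM; [apply: diff_on_diff Hf Ux|apply: diff_on_diff Hg Ux].
move=> oU; elim: k f g => [|k IH] f g Hf Hg; split=> //.
- exact: dM Hf Hg.
- exact: dM Hf Hg.
move=> v; apply: (@diff_on_eq _ _ _ _ (f * 'D_v g + g * 'D_v f)) => //.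
  move=> x Ux; rewrite deriveM ?fctE //.
    by apply/diff_derivable/(diff_on_diff Hf).
  by apply/diff_derivable/(diff_on_diff Hg).
have [[_ Df] [_ Dg]] := (Hf, Hg).
by apply: diff_onD => //; apply: IH; [exact: diff_onS|exact: Dg|exact: diff_onS|exact: Df].
Qed.

End Closure.

Lemma open_preimage_on (T S : topologicalType) (U : set T) (V : set S)
    (f : T -> S) :
  open U -> (forall x, U x -> {for x, continuous f}) -> open V ->
  open (U `&` f @^-1` V).
Proof.
rewrite !openE => oU cf oV x [Ux Vfx]; apply: filterI; first exact: oU.
by apply: cf => //; exact: oV.
Qed.

Definition row_coord m (j : 'I_m) (v : 'rV[R]_m) : R := v 0 j.

Fact row_coord_is_linear m (j : 'I_m) : linear (@row_coord m j).
Proof. by move=> a u v; rewrite /row_coord !mxE. Qed.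

HB.instance Definition _ m (j : 'I_m) :=
  GRing.isLinear.Build R 'rV[R]_m R _ (@row_coord m j) (@row_coord_is_linear m j).

Lemma diff_on_comp m n k (U : set 'rV[R]_n) (V : set 'rV[R]_m)
    (h : 'rV[R]_n -> 'rV[R]_m) (f : 'rV[R]_m -> R) :
  open U -> open V -> (forall x, U x -> V (h x)) ->
  diff_on k U h -> diff_on k V f -> diff_on k U (f \o h).
Proof.
move=> oU oV hUV.
have dC j (f' : 'rV[R]_m -> R) : diff_on j U h -> diff_on j V f' ->
    forall x, U x -> differentiable (f' \o h) x.
  move=> Hh Hf x Ux; apply: differentiable_comp; first exact: diff_on_diff Hh Ux.
  by apply: diff_on_diff Hf _; exact: hUV.
elim: k f => [|k IH] f Hh Hf; split=> //.
- exact: dC Hh Hf.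
- exact: dC Hh Hf.
move=> v.
pose term (j : 'I_m) : 'rV[R]_n -> R :=
  (row_coord j \o 'D_v h) * ('D_(delta_mx 0 j) f \o h).
pose S : 'rV[R]_n -> R := \sum_j term j.
apply: (diff_on_eq (g := S)) => //.
  move=> x Ux; have dh := diff_on_diff Hh Ux.
  have df := diff_on_diff Hf (hUV _ Ux).
  rewrite deriveE; last exact: differentiable_comp.
  rewrite diff_comp //= -(deriveE v dh).
  rewrite [X in 'd f _ X]row_sum_delta linear_sum /S fct_sumE.
  by apply: eq_bigr => j _; rewrite linearZ /= -(deriveE _ df).
rewrite /S; elim/big_ind: _.
- exact: diff_on_cst.
- by move=> *; exact: diff_onD.
- move=> j _; apply: diff_onM => //.
    apply: (diff_on_lin (L := row_coord j)) => //; first exact: coord_continuous.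
    by case: Hh => _; apply.
  by have [_ Df] := Hf; apply: IH; [exact: diff_onS|exact: Df].
Qed.

End EuclideanSmoothness.

Section Manifolds.
Context {R : realType}.

Record chart (M : topologicalType) (n : nat) := Chart {
  cdom : set M;
  cmap :> M -> 'rV[R]_n;
  cinv : 'rV[R]_n -> M;
  cdom_open : open cdom;
  cimg_open : open (cmap @` cdom);
  cmapK : forall x, cdom x -> cinv (cmap x) = x;
  cmap_continuous : forall x, cdom x -> {for x, continuous cmap};
  cinv_continuous : forall y, (cmap @` cdom) y -> {for y, continuous cinv}
}.

Record manifold (n : nat) := Manifold {
  mtop :> topologicalType;
  atlas : set (chart mtop n);
  manifold_hausdorff : hausdorff_space mtop;
  manifold_second_countable : @second_countable mtop;
  atlas_cover : forall x : mtop, exists2 c, atlas c & cdom c x;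
  atlas_compatible : forall c d, atlas c -> atlas d ->
    smooth_on (c @` (cdom c `&` cdom d)) (d \o cinv c)
}.

Definition smooth_fun_on n (M : manifold n) (A : set M) (f : M -> R) : Prop :=
  forall c, atlas c -> smooth_on (c @` (cdom c `&` A)) (f \o cinv c).

Lemma chart_image_open n (M : manifold n) (c : chart M n) (A : set M) :
  open A -> open (c @` (cdom c `&` A)).
Proof.
move=> oA.
have -> : c @` (cdom c `&` A) = c @` cdom c `&` cinv c @^-1` A.
  apply/seteqP; split => y /=.
    by move=> [x [cx Ax] <-]; split; [exists x|rewrite cmapK].
  by move=> [[x cx <-]]; rewrite cmapK // => Ax; exists x.
apply: open_preimage_on => //; first exact: cimg_open.
exact: cinv_continuous.
Qed.

Section SmoothFunctions.
Variables (n : nat) (M : manifold n).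

Definition smooth_fun : {pred M -> R} :=
  fun f => `[< smooth_fun_on setT f >].

Lemma smooth_fun_cst a : cst a \in smooth_fun.
Proof. by apply/asboolP => c _ k; exact: diff_on_cst. Qed.

Lemma smooth_funD : {in smooth_fun &, forall f g, f + g \in smooth_fun}.
Proof.
move=> f g /asboolP sf /asboolP sg; apply/asboolP => c Ac k.
have oU := chart_image_open (c := c) (@openT M).
exact: diff_onD oU (sf _ Ac k) (sg _ Ac k).
Qed.

Lemma smooth_funM : {in smooth_fun &, forall f g, f * g \in smooth_fun}.
Proof.
move=> f g /asboolP sf /asboolP sg; apply/asboolP => c Ac k.
have oU := chart_image_open (c := c) (@openT M).
exact: diff_onM oU (sf _ Ac k) (sg _ Ac k).
Qed.

Lemma smooth_funZ a : {in smooth_fun, forall f, a *: f \in smooth_fun}.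
Proof. by move=> f sf; exact: smooth_funM (smooth_fun_cst a) sf. Qed.

Lemma smooth_fun_subring_closed : subring_closed smooth_fun.
Proof.
split; [exact: smooth_fun_cst| |exact: smooth_funM].
move=> f g sf sg; rewrite -scaleN1r; apply: smooth_funD => //.
exact: smooth_funZ.
Qed.

HB.instance Definition _ :=
  GRing.isSubringClosed.Build (M -> R) smooth_fun smooth_fun_subring_closed.
HB.instance Definition _ :=
  GRing.isScaleClosed.Build R (M -> R) smooth_fun smooth_funZ.

Record cinf := Cinf {
  cinf_fun :> M -> R;
  cinf_smooth : cinf_fun \in smooth_fun
}.

HB.instance Definition _ := [isSub for cinf_fun].
HB.instance Definition _ := [Choice of cinf by <:].
HB.instance Definition _ := 
  GRing.SubChoice_isSubComPzRing.Build (M -> R) smooth_fun cinf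
    smooth_fun_subring_closed.
HB.instance Definition _ := [SubZmodule_isSubLmodule of cinf by <:].

(* Tangent vectors at x are the derivations of C^oo(M) at x. *)
Definition derivation_at (x : M) : {pred cinf -> R} := fun v =>
  `[< (forall (a : R) (f g : cinf), v (a *: f + g) = a * v f + v g) /\
      (forall f g : cinf, v (f * g) = f x * v g + g x * v f) >].

Lemma derivation_submod_closed x : submod_closed (derivation_at x).
Proof.
split=> [|a u v /asboolP[uL uM] /asboolP[vL vM]]; apply/asboolP.
  have E (h : cinf) : (0 : cinf -> R) h = 0 by [].
  by split=> *; rewrite !E ?mulr0 addr0.
have E (h : cinf) : (a *: u + v) h = a * u h + v h by [].
by split=> [b f g|f g]; rewrite !E ?uL ?uM ?vL ?vM; ring.
Qed.

HB.instance Definition _ x :=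
  GRing.isSubmodClosed.Build R (cinf -> R) (derivation_at x)
    (derivation_submod_closed x).

Record tangent (x : M) := Tangent {
  tangent_fun :> cinf -> R;
  tangentP : tangent_fun \in derivation_at x
}.

HB.instance Definition _ x := [isSub for @tangent_fun x].
HB.instance Definition _ x := [Choice of tangent x by <:].
HB.instance Definition _ x := [SubChoice_isSubLmodule of tangent x by <:].

Lemma tangentL x (v : tangent x) a (f g : cinf) :
  v (a *: f + g) = a * v f + v g.
Proof. by have /asboolP[+ _] := tangentP v; apply. Qed.

Lemma tangentM x (v : tangent x) (f g : cinf) :
  v (f * g) = f x * v g + g x * v f.
Proof. by have /asboolP[_] := tangentP v; apply. Qed.

Definition smooth_section_on (A : set M) (X : forall x, tangent x) : Prop :=
  forall f : cinf, smooth_fun_on A (fun x => X x f).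

Record vfield := VField {
  vfield_fun :> forall x, tangent x;
  vfield_smooth : smooth_section_on setT vfield_fun
}.

Lemma lie_derivative_smooth (X : vfield) (f : cinf) :
  (fun x => X x f) \in smooth_fun.
Proof. by apply/asboolP; exact: vfield_smooth. Qed.

Definition lie_derivative (X : vfield) (f : cinf) : cinf :=
  Cinf (lie_derivative_smooth X f).

Lemma lie_derivativeL X a f g :
  lie_derivative X (a *: f + g) = a *: lie_derivative X f + lie_derivative X g.
Proof. by apply/val_inj/funext => x; exact: tangentL. Qed.

Lemma lie_derivativeM X f g :
  lie_derivative X (f * g) = f * lie_derivative X g + g * lie_derivative X f.
Proof. by apply/val_inj/funext => x; exact: tangentM. Qed.

Lemma bracket_derivation (X Y : vfield) x :
  (fun f : cinf => X x (lie_derivative Y f) - Y x (lie_derivative X f))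
    \in derivation_at x.
Proof.
have tD (Z : vfield) (f g : cinf) : Z x (f + g) = Z x f + Z x g.
  by rewrite -[f in LHS]scale1r tangentL mul1r.
apply/asboolP; split=> [a f g|f g].
  rewrite !lie_derivativeL !tangentL; ring.
rewrite !lie_derivativeM !tD !tangentM /=; ring.
Qed.

Lemma bracket_smooth (X Y : vfield) :
  smooth_section_on setT (fun x => Tangent (bracket_derivation X Y x)).
Proof.
move=> f; apply/asboolP.
rewrite (_ : (fun x => _) = cinf_fun
  (lie_derivative X (lie_derivative Y f) - lie_derivative Y (lie_derivative X f))).
  exact: cinf_smooth.
by [].
Qed.

Definition lie_bracket (X Y : vfield) : vfield := VField (bracket_smooth X Y).

Record tensor11 := Tensor11 {
  tensor11_fun :> forall x, {linear tangent x -> tangent x};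
  tensor11_smooth : forall X : vfield,
    smooth_section_on setT (fun x => tensor11_fun x (X x))
}.

Definition tensor_field (F : tensor11) (X : vfield) : vfield :=
  VField (tensor11_smooth F X).

Record riemannian_metric := Metric {
  metric_fun :> forall x, tangent x -> tangent x -> R;
  metric_linear : forall x a (u v w : tangent x),
    metric_fun (a *: u + v) w = a * metric_fun u w + metric_fun v w;
  metric_sym : forall x (u v : tangent x), metric_fun u v = metric_fun v u;
  metric_pos : forall x (v : tangent x), v != 0 -> 0 < metric_fun v v;
  metric_smooth : forall X Y : vfield,
    smooth_fun_on setT (fun x => metric_fun (X x) (Y x))
}.

(* A distribution is a smooth subbundle of the tangent bundle; its rank is
   locally constant. *)
Definition is_distribution (D : forall x, set (tangent x)) : Prop :=
  forall x, exists (U : set M) (k : nat) (E : 'I_k -> forall y, tangent y),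
    [/\ open U, U x, forall i, smooth_section_on U (E i),
      forall y, U y -> forall a : 'I_k -> R,
        \sum_i a i *: E i y = 0 -> forall i, a i = 0 &
      forall y, U y -> D y = [set \sum_i a i *: E i y | a in [set: 'I_k -> R]]].

Definition section_of (D : forall x, set (tangent x)) (X : vfield) : Prop :=
  forall x, D x (X x).

(* D is integrable (involutive) when its sections are closed under the Lie
   bracket; existence of integral manifolds is then the Frobenius theorem. *)
Definition integrable_distribution (D : forall x, set (tangent x)) : Prop :=
  forall X Y, section_of D X -> section_of D Y -> section_of D (lie_bracket X Y).

Definition nijenhuis (phi : tensor11) (X Y : vfield) (x : M) : tangent x :=
  lie_bracket (tensor_field phi X) (tensor_field phi Y) x
  + phi x (phi x (lie_bracket X Y x))
  - phi x (lie_bracket (tensor_field phi X) Y x)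
  - phi x (lie_bracket X (tensor_field phi Y) x).

Definition gFmu_manifold (g : riemannian_metric) (F : tensor11) (mu : R) : Prop :=
  forall (X Y : vfield) x,
    g x (F x (X x)) (Y x) + mu * g x (X x) (F x (Y x)) = 0.

Definition nondegenerate_tensor (F : tensor11) : Prop := forall x, bijective (F x).

End SmoothFunctions.

Section SmoothMaps.
Variables (n m : nat) (N : manifold n) (M : manifold m).

Record smooth_map := SmoothMap {
  smooth_map_fun :> N -> M;
  smooth_map_continuous : continuous smooth_map_fun;
  smooth_mapP : forall c d, atlas c -> atlas d ->
    smooth_on (c @` (cdom c `&` smooth_map_fun @^-1` cdom d))
              (d \o smooth_map_fun \o cinv c)
}.

Variable h : smooth_map.

Lemma pullback_smooth (f : cinf M) : f \o h \in @smooth_fun n N.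
Proof.
apply/asboolP => c Ac k; apply: diff_on_local => _ [x [cx _] <-].
have [d Ad dhx] := atlas_cover (h x).
have oh : open (h @^-1` cdom d).
  by move/continuousP: (@smooth_map_continuous h); apply; exact: cdom_open.
pose A := c @` (cdom c `&` h @^-1` cdom d).
exists A, ((f \o cinv d) \o (d \o h \o cinv c)); split.
- exact: chart_image_open.
- by exists x.
- apply: (@diff_on_comp _ _ _ _ _ (d @` (cdom d `&` setT))).
  + exact: chart_image_open.
  + exact: chart_image_open (@openT M).
  + by move=> _ [y [cy dhy] <-] /=; rewrite cmapK //; exists (h y).
  + exact: smooth_mapP.
  + by have /asboolP sf := cinf_smooth f; exact: sf.
- by move=> _ [y [cy dhy] <-] /=; rewrite !cmapK.
Qed.

Definition pullback (f : cinf M) : cinf N := Cinf (pullback_smooth f).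

Lemma differential_subproof x (v : tangent x) :
  (fun f : cinf M => v (pullback f)) \in derivation_at (h x).
Proof.
apply/asboolP; split=> [a f g|f g].
  by rewrite -tangentL; congr (v _); exact/val_inj.
rewrite (_ : pullback (f * g) = pullback f * pullback g) ?tangentM //.
exact/val_inj.
Qed.

Definition differential x (v : tangent x) : tangent (h x) :=
  Tangent (differential_subproof v).

Lemma differential_linear x : linear (@differential x).
Proof. by move=> a u v; exact/val_inj. Qed.

HB.instance Definition _ x :=
  GRing.isLinear.Build R (tangent x) (tangent (h x)) _ (@differential x)
    (@differential_linear x).

(* An injective immersion; embedded submanifolds are the case where h is
   moreover a homeomorphism onto its image. *)
Definition immersed_submanifold : Prop :=
  injective h /\ forall x, injective (@differential x).

Section SemiInvariant.
Variables (g : riemannian_metric M) (F : tensor11 M).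
Implicit Type D : forall x : N, set (tangent x).

Definition induced_metric (x : N) (v w : tangent x) : R :=
  g (h x) (differential v) (differential w).

Definition orth_compl D (x : N) : set (tangent x) :=
  [set v | forall w, D x w -> induced_metric v w = 0].

Definition normal_fiber (x : N) : set (tangent (h x)) :=
  [set u | forall w : tangent x, g (h x) u (differential w) = 0].

(* Here and below, T_xN is identified with its image in T_{h x}M under the
   differential. *)
Record semi_invariant D : Prop := SemiInvariant {
  semi_invariant_distribution : is_distribution D;
  semi_invariant_inv : forall x,
    F (h x) @` (@differential x @` D x) `<=` @differential x @` D x;
  semi_invariant_anti : forall x,
    F (h x) @` (@differential x @` @orth_compl D x) `<=` @normal_fiber x;
  semi_invariant_sq : exists2 E : forall x : N, set (tangent x),
    is_distribution E &
    forall x, F (h x) @` (F (h x) @` (@differential x @` @orth_compl D x))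
      = @differential x @` E x
}.

Definition orth_projection D (P : tensor11 N) : Prop :=
  forall x v, D x (P x v) /\ @orth_compl D x (v - P x v).

Definition is_composite (P phi : tensor11 N) : Prop :=
  forall x (v : tangent x), differential (phi x v) = F (h x) (differential (P x v)).

End SemiInvariant.
End SmoothMaps.

End Manifolds.

Arguments chart : clear implicits.
Arguments manifold : clear implicits.
Arguments orth_compl {R n m N M} h g D x _.
Arguments normal_fiber {R n m N M} h g x _.
Arguments semi_invariant {R n m N M} h g F D.
Arguments orth_projection {R n m N M} h g D P.
Arguments is_composite {R n m N M} h F P phi.

(* Main.v *)
(** For [X], [Y] in the anti-invariant distribution, [phi X = phi Y = 0], so the
    Nijenhuis tensor reduces to [phi^2 [X, Y]]. As [F] is injective and maps [D]
    into itself, [phi] has kernel [orth_compl D] and image in [D], hence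
    [phi^2 v = 0] iff [v] is orthogonal to [D]. *)
Require Import Defs.
From HB Require Import structures.
From mathcomp Require Import all_boot all_order all_algebra.
From mathcomp Require Import boolp classical_sets functions.
From mathcomp Require Import reals topology normedtype derive.

Import GRing.Theory Num.Theory.
Local Open Scope classical_set_scope.
Local Open Scope ring_scope.

Lemma tangent_0 (R : realType) (n : nat) (M : manifold R n) (x : M)
    (v : tangent x) : v 0 = 0.
Proof.
(* A tangent vector coerces to a bare function, so its additivity must come from [tangentL]: these
   arguments give [v 0 = - v 0 + v 0]. *)
by have := tangentL v (-1) 0 0; rewrite scaler0 addr0 mulN1r addNr.
Qed.

(** [X] must vanish everywhere, not only at [x], because [Y x] differentiates the function [X f]. *)
Lemma lie_bracket_0l (R : realType) (n : nat) (M : manifold R n)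
    (X Y : vfield M) : (forall x, X x = 0) -> forall x, lie_bracket X Y x = 0.
Proof.
move=> X0 x; apply/val_inj/funext => f /=.
have -> : lie_derivative X f = 0 by apply/val_inj/funext => y /=; rewrite X0.
by rewrite X0 tangent_0 subr0.
Qed.

Lemma lie_bracket_0r (R : realType) (n : nat) (M : manifold R n)
    (X Y : vfield M) : (forall x, Y x = 0) -> forall x, lie_bracket X Y x = 0.
Proof.
move=> Y0 x; apply/val_inj/funext => f /=.
have -> : lie_derivative Y f = 0 by apply/val_inj/funext => y /=; rewrite Y0.
by rewrite Y0 tangent_0 subr0.
Qed.

Lemma nijenhuis_ker (R : realType) (n : nat) (M : manifold R n)
    (phi : tensor11 M) (X Y : vfield M) :
  (forall x, phi x (X x) = 0) -> (forall x, phi x (Y x) = 0) ->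
  forall x, nijenhuis phi X Y x = phi x (phi x (lie_bracket X Y x)).
Proof.
move=> X0 Y0 x; rewrite /nijenhuis.
(* One rewrite per second argument: the brackets of [phi X] with [phi Y] and with [Y]. *)
rewrite (lie_bracket_0l _ _ _ (tensor_field phi X)) //.
rewrite (lie_bracket_0l _ _ _ (tensor_field phi X)) //.
by rewrite (lie_bracket_0r _ _ _ _ (tensor_field phi Y)) // !raddf0 add0r !addr0.
Qed.

Section SemiInvariant.
Variables (R : realType) (m n : nat) (M : manifold R m) (N : manifold R n).
Variables (g : riemannian_metric M) (F : tensor11 M) (h : smooth_map N M).
Hypothesis diff_inj : forall x : N, injective (@differential R n m N M h x).
Variable D : forall x : N, set (tangent x).

(** Pairing [v] with itself makes the differential of [v] a null vector of [g], hence zero; the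
    immersion then gives [v = 0]. *)
Lemma orth_compl_disjoint (x : N) (v : tangent x) :
  D x v -> orth_compl h g D x v -> v = 0.
Proof.
move=> Dv /(_ _ Dv) gvv; apply: (diff_inj x); rewrite linear0.
apply/eqP/negPn/negP => /(metric_pos g).
by rewrite [g _ _ _]gvv Order.POrderTheory.ltxx.
Qed.

Variable P : tensor11 N.
Hypothesis projP : orth_projection h g D P.

Lemma orth_projection_ker (x : N) (v : tangent x) :
  P x v = 0 <-> orth_compl h g D x v.
Proof.
have [DPv oPv] := projP x v; split=> [Pv0|ov].
  by move: oPv; rewrite Pv0 subr0.
(* [P x v] lies in [D]; as the difference of [v] and [v - P x v] it is also orthogonal to [D]. The
   scalar [-1] fits the shape of [metric_linear]. *)
apply: orth_compl_disjoint => // w Dw.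
have -> : P x v = (-1) *: (v - P x v) + v by rewrite scaleN1r opprB subrK.
rewrite /induced_metric [differential _ _]linearP metric_linear.
by rewrite [X in _ * X](oPv w Dw) mulr0 add0r; exact: ov.
Qed.

Variable phi : tensor11 N.
Hypothesis phiE : is_composite h F P phi.
Hypothesis F_inj : forall x, injective (F x).

Lemma composite_ker (x : N) (v : tangent x) :
  phi x v = 0 <-> orth_compl h g D x v.
Proof.
rewrite -orth_projection_ker; split=> [phi0|P0]; apply: (diff_inj x).
  by apply: F_inj; rewrite -phiE phi0 !linear0.
by rewrite phiE P0 !linear0.
Qed.

Hypothesis semiD : semi_invariant h g F D.

Lemma composite_img (x : N) (v : tangent x) : D x (phi x v).
Proof.
have [DPv _] := projP x v.
have : (@differential _ _ _ _ _ h x @` D x) (differential h (phi x v)).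
  rewrite phiE; apply: (semi_invariant_inv semiD).
  by exists (differential h (P x v)) => //; exists (P x v).
(* Invariance of [D] under [F] only holds inside the tangent spaces of [M]; injectivity of the
   differential brings it back to [N]. *)
by move=> [w Dw /diff_inj <-].
Qed.

(** If [phi] kills [phi x v], that vector is orthogonal to [D] while lying in [D], so it is already
    zero. *)
Lemma composite_sq_ker (x : N) (v : tangent x) :
  phi x (phi x v) = 0 <-> orth_compl h g D x v.
Proof.
rewrite -(composite_ker x v); split=> [/composite_ker o|->]; last exact: linear0.
by apply: orth_compl_disjoint o; exact: composite_img.
Qed.

End SemiInvariant.

Theorem theorem3p3 (R : realType) (m n : nat)
    (M : manifold R m) (g : riemannian_metric M) (F : tensor11 M)
    (mu : R) (hmu : mu = -1 \/ mu = 1)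
    (hM : gFmu_manifold g F mu) (hF : nondegenerate_tensor F)
    (N : manifold R n) (h : smooth_map N M) (hN : immersed_submanifold h)
    (D : forall x : N, set (tangent x)) (hD : semi_invariant h g F D)
    (P : tensor11 N) (hP : orth_projection h g D P)
    (phi : tensor11 N) (hphi : is_composite h F P phi) :
  integrable_distribution (orth_compl h g D) <->
  (forall X Y : vfield N,
     section_of (orth_compl h g D) X -> section_of (orth_compl h g D) Y ->
     forall x : N, nijenhuis phi X Y x = 0).
Proof.
have [_ dh_inj] := hN.
have F_inj x : injective (F x) by exact: bij_inj.
have ker := composite_ker R m n M N g F h dh_inj D P hP phi hphi F_inj.
have ker2 := composite_sq_ker R m n M N g F h dh_inj D P hP phi hphi F_inj hD.
have nijE X Y : section_of (orth_compl h g D) X ->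
    section_of (orth_compl h g D) Y -> forall x : N,
    nijenhuis phi X Y x = phi x (phi x (lie_bracket X Y x)).
  by move=> oX oY; apply: nijenhuis_ker => x; apply/ker.
split=> [int X Y oX oY x|nij0 X Y oX oY x].
  by rewrite nijE //; apply/ker2; exact: int.
by apply/ker2; rewrite -nijE //; exact: nij0.
Qed.
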